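(* Let $q$ be a prime power and let $B\subset\mathbb{P}^2$ be the Ballico-Hefez curve over $\mathbb{F}_q$, i.e. the image of the morphism $\Phi:\mathbb{P}^1\to\mathbb{P}^2$, $\Phi(s,t)=(s^{q+1},\,s^{q}t+st^{q},\,t^{q+1})$. Then $B$ is a plane curve of degree $q+1$, and the number $N_q(B)$ of its $\mathbb{F}_q$-points is $$N_q(B)=q+1+\frac{q(q-1)}{2}.$$
   Context: $\mathbb{P}^1,\mathbb{P}^2$ are projective spaces over an algebraic closure $\overline{\mathbb{F}}_q$ of $\mathbb{F}_q$, and $B$ is the plane curve $\Phi(\mathbb{P}^1)$ (with reduced structure), which is defined over $\mathbb{F}_q$. $B(\mathbb{F}_q)$ is the set of points of $B$ in $\mathbb{P}^2(\mathbb{F}_q)$ and $N_q(B)$ is its cardinality. *)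

(* Defs.v *)
From HB Require Import structures.
From mathcomp Require Import all_boot all_order all_algebra all_field.
From mathcomp Require Import mpoly.
From mathcomp Require Import boolp classical_sets functions cardinality.

Set Implicit Arguments.
Unset Strict Implicit.
Unset Printing Implicit Defensive.

Import GRing.Theory.

Local Open Scope classical_set_scope.
Local Open Scope ring_scope.

Section ProjectiveSpace.
Variables (K : fieldType) (n : nat).

(* P^n(K): the points are the lines through the origin of K^(n+1). *)
Definition proj : Type := {U : {vspace 'rV[K]_n.+1} | \dim U == 1%N}.

HB.instance Definition _ := Choice.on proj.

Definition homcoord (v : 'rV[K]_n.+1) (P : proj) : Prop := val P = <[v]>%VS.

Lemma dim_line_eq1 (v : 'rV[K]_n.+1) : v != 0 -> \dim <[v]> == 1%N.
Proof. by rewrite dim_vline => ->. Qed.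

Definition proj_pt (v : 'rV[K]_n.+1) (v0 : v != 0) : proj :=
  exist _ <[v]>%VS (dim_line_eq1 v0).

Definition proj_repr (P : proj) : 'rV[K]_n.+1 := vpick (val P).

Lemma proj_repr_neq0 (P : proj) : proj_repr P != 0.
Proof. by rewrite vpick0 -dimv_eq0 (eqP (valP P)). Qed.

Lemma homcoord_repr (P : proj) : homcoord (proj_repr P) P.
Proof.
apply/esym/eqP; rewrite eqEdim -memvE memv_pick dim_vline proj_repr_neq0.
by rewrite (eqP (valP P)).
Qed.

Lemma homcoord_neq0 (v : 'rV[K]_n.+1) (P : proj) : homcoord v P -> v != 0.
Proof.
move=> hv; have := valP P.
by rewrite hv dim_vline; case: (v != 0).
Qed.

Lemma homcoord_scale (v w : 'rV[K]_n.+1) (P : proj) :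
  homcoord v P -> homcoord w P -> exists2 c : K, c != 0 & w = c *: v.
Proof.
move=> hv hw; have : w \in val P by rewrite hw memv_line.
rewrite hv => /vlineP[c wE]; exists c => //.
by apply: contra_neq (homcoord_neq0 hw) => c0; rewrite wE c0 scale0r.
Qed.

(* Vanishing is tested on all homogeneous coordinates of P, so that it is
   meaningful also for polynomials that are not homogeneous. *)
Definition vanishes_at (f : {mpoly K[n.+1]}) (P : proj) : Prop :=
  forall v : 'rV[K]_n.+1, homcoord v P -> f.@[fun i => v 0 i] = 0.

Definition zero_locus (f : {mpoly K[n.+1]}) : set proj :=
  [set P | vanishes_at f P].

(* The (radical, homogeneous) ideal I(C), i.e. the ideal of C with its reduced
   structure. *)
Definition vanishing_ideal (C : set proj) : set {mpoly K[n.+1]} :=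
  [set g | forall P, C P -> vanishes_at g P].

End ProjectiveSpace.

Section BaseChange.
Variables (F K : fieldType) (iota : {rmorphism F -> K}).

Lemma map_repr_neq0 n (P : proj F n) : map_mx iota (proj_repr P) != 0.
Proof. by rewrite map_mx_eq0 proj_repr_neq0. Qed.

Definition proj_map n (P : proj F n) : proj K n := proj_pt (map_repr_neq0 P).

Lemma proj_mapE n (v : 'rV[F]_n.+1) (P : proj F n) :
  homcoord v P -> homcoord (map_mx iota v) (proj_map P).
Proof.
move=> hv; have [c c0 ->] := homcoord_scale (homcoord_repr P) hv.
rewrite /homcoord /= map_mxZ; apply/eqP; rewrite eqEdim !dim_vline.
rewrite scaler_eq0 fmorph_eq0 (negPf c0) /= leqnn andbT -memvE.
apply/vlineP; exists (iota c)^-1.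
by rewrite scalerA mulVf ?scale1r // fmorph_eq0.
Qed.

Definition rational_points n (C : set (proj K n)) : set (proj K n) :=
  C `&` range (@proj_map n).

(* C (with its reduced structure) is a plane curve over F of degree d: it is
   the zero locus of a nonconstant form f of degree d with coefficients in F,
   and f generates the ideal of C over K. *)
Definition plane_curve_of_degree (d : nat) (C : set (proj K 2)) : Prop :=
  (0 < d)%N /\
  exists f : {mpoly F[3]},
    [/\ f != 0, f \is d.-homog,
        C = zero_locus (map_mpoly iota f)
      & vanishing_ideal C = [set g | exists h, g = h * map_mpoly iota f]].

End BaseChange.

Section BallicoHefez.
Variables (K : fieldType) (q : nat).

Definition Phi_coord (v : 'rV[K]_2) : 'rV[K]_3 :=
  let s := v 0 0 in let t := v 0 1 in
  \row_i [:: s ^+ q.+1; s ^+ q * t + s * t ^+ q; t ^+ q.+1]`_i.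

Lemma Phi_coord_neq0 (v : 'rV[K]_2) : v != 0 -> Phi_coord v != 0.
Proof.
apply: contra_neq => /rowP Phi0.
have := Phi0 0; have := Phi0 2; rewrite !mxE /= => /eqP + /eqP.
rewrite !expf_eq0 /= => /eqP t0 /eqP s0; apply/rowP=> i; rewrite mxE.
case: i => [[|[|//]]] lti; [rewrite -s0 | rewrite -t0];
  by congr (v _ _); apply: val_inj.
Qed.

Lemma Phi_coordZ (c : K) (v : 'rV[K]_2) :
  Phi_coord (c *: v) = c ^+ q.+1 *: Phi_coord v.
Proof.
apply/rowP => i; rewrite !mxE !exprMn.
case: i => [[|[|[|//]]]] lti //=.
by rewrite mulrACA -exprSr mulrACA -exprS -mulrDr.
Qed.

Definition Phi (P : proj K 1) : proj K 2 :=
  proj_pt (Phi_coord_neq0 (proj_repr_neq0 P)).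

Lemma PhiE (v : 'rV[K]_2) (P : proj K 1) :
  homcoord v P -> homcoord (Phi_coord v) (Phi P).
Proof.
move=> hv; have [c c0 ->] := homcoord_scale (homcoord_repr P) hv.
rewrite /homcoord /= Phi_coordZ; apply/eqP; rewrite eqEdim !dim_vline.
rewrite scaler_eq0 expf_eq0 (negPf c0) andbF /= leqnn andbT -memvE.
apply/vlineP; exists (c ^+ q.+1)^-1.
by rewrite scalerA mulVf ?scale1r // expf_neq0.
Qed.

Definition ballico_hefez : set (proj K 2) := range Phi.

End BallicoHefez.

Arguments ballico_hefez : clear implicits.

(* Main.v *)
Require Import Defs.
From HB Require Import structures.
From mathcomp Require Import all_boot all_order all_algebra all_field.
From mathcomp Require Import mpoly ring.
From mathcomp Require Import boolp classical_sets functions cardinality.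

Import GRing.Theory.

Local Open Scope classical_set_scope.
Local Open Scope card_scope.
Local Open Scope ring_scope.

(** Let a and b be the roots of T^2 - y T + x.  In the affine chart t = 1 the
map is s |-> (x, y) = (s s^q, s + s^q), so (x, y) lies on the curve exactly
when one of a, b is the q-th power of the other, that is, when
[(a^q - b) (b^q - a) = (a b)^q + a b - (a^(q+1) + b^(q+1))] vanishes.  The power
sum is the Dickson polynomial in y = a + b and x = a b, with integer
coefficients; homogenizing gives the form
  [f = x^q z + x z^q - D_(q+1)(y, x z)]
of degree q + 1 with coefficients in the prime field ([bh_form]), whose zero
locus is the curve ([ballico_hefez_zero_locus]).

That f generates the whole ideal of the curve follows from its being monic in y
up to sign.  Division leaves a remainder of degree at most q in y, which
still vanishes on the curve.  Fix x = s^(q+1) and z = t^(q+1); replacing s by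
w s with w^(q+1) = 1 moves only y, and unless x^q z = x z^q the q + 1 values of
y so obtained are distinct ([fiber_poly_eq0]; the roots of unity are distinct
because q + 1 = 1 in K).  The remainder therefore vanishes over a Zariski dense
set of (x, z), so it is zero ([bh_poly_dvd]).

For the points over F, the only one with z = 0 is (1 : 0 : 0).  When z = 1 and
x, y lie in F, the q-power map permutes {a, b}.  If T^2 - y T + x is irreducible
it exchanges a and b, and if a = b it fixes the double root; in both cases
(x : y : 1) is on the curve.  It is off the curve precisely when a and b are
distinct elements of F ([bh_form_neq0P]), and such pairs (x, y) correspond to
the two-element subsets of F.  So the count is
1 + q^2 - q (q - 1) / 2 = q + 1 + q (q - 1) / 2. *)

(** * Dickson polynomials and the equation of the curve *)

(** The Dickson polynomial of the first kind D_n(y, w): the power sum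
[a^n + b^n] written in terms of y = a + b and w = a b. *)
Fixpoint dickson {R : comNzRingType} (y w : R) (n : nat) : R :=
  if n is m.+1 then
    if m is k.+1 then y * dickson y w m - w * dickson y w k else y
  else 2%:R.

Definition bh_form {R : comNzRingType} (q : nat) (x y z : R) : R :=
  x ^+ q * z + x * z ^+ q - dickson y (x * z) q.+1.

Section Identities.
Variables (R : comNzRingType) (q : nat).
Implicit Types a b c s t x y z w : R.

Lemma dicksonS y w n :
  dickson y w n.+2 = y * dickson y w n.+1 - w * dickson y w n.
Proof. by []. Qed.

Lemma pair_ind_nat (P : nat -> Prop) :
  P 0%N -> P 1%N -> (forall n, P n -> P n.+1 -> P n.+2) -> forall n, P n.
Proof.
move=> P0 P1 PS n; suff: P n /\ P n.+1 by case.
by elim: n => [|n [Pn PSn]]; split=> //; apply: PS.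
Qed.

Lemma dickson_power_sum a b n : dickson (a + b) (a * b) n = a ^+ n + b ^+ n.
Proof.
elim/pair_ind_nat: n => [||n IHn IHSn]; rewrite ?dicksonS ?IHn ?IHSn //=.
by rewrite !exprS; ring.
Qed.

Lemma dickson0r y n : dickson y 0 n.+1 = y ^+ n.+1.
Proof. by elim: n => // n IHn; rewrite dicksonS IHn mul0r subr0 -exprS. Qed.

(** The factorization from which the equation is derived: in the chart z = 1 the
form tests whether one root of T^2 - y T + x is the q-th power of the other. *)
Lemma bh_form_roots a b :
  bh_form q (a * b) (a + b) 1 = (a ^+ q - b) * (b ^+ q - a).
Proof.
by rewrite /bh_form !mulr1 dickson_power_sum expr1n exprMn !exprS; ring.
Qed.

(** Here the roots are a = s^q t and b = s t^q. *)
Lemma bh_form_param s t :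
  bh_form q (s ^+ q.+1) (s ^+ q * t + s * t ^+ q) (t ^+ q.+1) = 0.
Proof.
rewrite /bh_form.
have -> : s ^+ q.+1 * t ^+ q.+1 = (s ^+ q * t) * (s * t ^+ q).
  by rewrite !exprS; ring.
rewrite dickson_power_sum !exprMn -!exprM [(q.+1 * q)%N]mulnC.
exact: subrr.
Qed.

Lemma bh_form_z0 x y : (0 < q)%N -> bh_form q x y 0 = - y ^+ q.+1.
Proof.
by move=> q_gt0; rewrite /bh_form expr0n eqn0Ngt q_gt0 !mulr0 dickson0r !add0r.
Qed.

Lemma dicksonZ c y w n :
  dickson (c * y) (c ^+ 2 * w) n = c ^+ n * dickson y w n.
Proof.
elim/pair_ind_nat: n => [||n IHn IHSn]; rewrite ?dicksonS ?IHn ?IHSn.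
- by rewrite mul1r.
- by [].
- by rewrite !exprS; ring.
Qed.

Lemma bh_formZ c x y z :
  bh_form q (c * x) (c * y) (c * z) = c ^+ q.+1 * bh_form q x y z.
Proof.
rewrite /bh_form mulrACA -expr2 dicksonZ mulrBr !exprMn !exprS; ring.
Qed.

End Identities.

Lemma rmorph_dickson (R S : comNzRingType) (f : {rmorphism R -> S}) y w n :
  f (dickson y w n) = dickson (f y) (f w) n.
Proof.
elim/pair_ind_nat: n => [||n IHn IHSn]; rewrite ?dicksonS ?rmorph_nat //=.
by rewrite rmorphB !rmorphM IHn IHSn.
Qed.

Lemma rmorph_bh_form (R S : comNzRingType) (f : {rmorphism R -> S}) q x y z :
  f (bh_form q x y z) = bh_form q (f x) (f y) (f z).
Proof.
by rewrite /bh_form rmorphB rmorphD !rmorphM !rmorphXn rmorph_dickson rmorphM.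
Qed.

(** This is what allows division by the equation with respect to y. *)
Lemma dickson_monic (R : comNzRingType) (w : R) n :
  dickson 'X w%:P n.+1 \is monic /\ size (dickson 'X w%:P n.+1) = n.+2.
Proof.
suff: [/\ dickson 'X w%:P n.+1 \is monic, size (dickson 'X w%:P n.+1) = n.+2
        & (size (dickson 'X w%:P n) <= n.+1)%N] by case.
elim: n => [|n [mon szS sz]].
  by split; rewrite /= ?monicX ?size_polyX // -polyC_natr size_polyC_leq1.
have szX : size ('X * dickson 'X w%:P n.+1) = n.+3.
  by rewrite mulrC size_mulX ?szS // monic_neq0.
have lt : (size (- (w%:P * dickson 'X w%:P n)) < n.+3)%N.
  rewrite size_polyN mul_polyC; apply: leq_ltn_trans (size_scale_leq _ _) _.
  by rewrite ltnS leqW.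
rewrite dicksonS szS; split=> //; last by rewrite size_polyDl szX.
by rewrite monicE lead_coefDl ?szX // -monicE monicMr ?monicX.
Qed.

Definition bh_poly (R : comNzRingType) (q : nat) : {mpoly R[3]} :=
  bh_form q 'X_0 'X_1 'X_2.

Lemma map_bh_poly (R S : comNzRingType) (f : {rmorphism R -> S}) q :
  map_mpoly f (bh_poly R q) = bh_poly S q.
Proof. by rewrite rmorph_bh_form /= !map_mpolyX. Qed.

Lemma bh_polyE (R : comNzRingType) q (v : 'I_3 -> R) :
  (bh_poly R q).@[v] = bh_form q (v 0) (v 1) (v 2).
Proof. by rewrite rmorph_bh_form /= !mevalXU. Qed.

Lemma bh_poly_homog (R : comNzRingType) q : bh_poly R q \is q.+1.-homog.
Proof.
have hX (i : 'I_3) : ('X_i : {mpoly R[3]}) \is 1.-homog.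
  by rewrite dhomogX /= mdeg1.
have hXn (i : 'I_3) n : ('X_i ^+ n : {mpoly R[3]}) \is n.-homog.
  by rewrite -[n in n.-homog]mul1n dhomogMn.
have hD n : dickson ('X_1 : {mpoly R[3]}) ('X_0 * 'X_2) n \is n.-homog.
  elim/pair_ind_nat: n => [||n IHn IHSn]; rewrite ?dicksonS ?hX //=.
    by rewrite rpredMn ?dhomog1.
  apply: rpredB; first exact: (dhomogM (hX 1) IHSn).
  exact: (dhomogM (dhomogM (hX 0) (hX 2)) IHn).
rewrite /bh_poly /bh_form rpredB // rpredD //.
  by have := dhomogM (hXn 0 q) (hX 2); rewrite addn1.
exact: (dhomogM (hX _) (hXn _ _)).
Qed.

Lemma bh_poly_neq0 (R : comNzRingType) q : (0 < q)%N -> bh_poly R q != 0.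
Proof.
move=> q_gt0; apply/eqP => /(congr1 (meval (fun i : 'I_3 => (i == 1)%:R))).
rewrite bh_polyE meval0 bh_form_z0 // expr1n.
by move/eqP; rewrite oppr_eq0 oner_eq0.
Qed.

(** * Polynomials in three variables as iterated polynomials *)

Section Evaluation.

(** The morphism extending [f] that sends the indeterminate to [u]. *)
Definition ev {A L : comNzRingType} (f : {rmorphism A -> L}) (u : L) :
    {rmorphism {poly A} -> L} :=
  horner_morph (fun a => mulrC u (f a)).

Lemma evC (A L : comNzRingType) (f : {rmorphism A -> L}) u a :
  ev f u a%:P = f a.
Proof. exact: horner_morphC. Qed.

Lemma evX (A L : comNzRingType) (f : {rmorphism A -> L}) u : ev f u 'X = u.
Proof. exact: horner_morphX. Qed.

Lemma rmorph_ev (A L M : comNzRingType) (f : {rmorphism A -> L})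
    (g : {rmorphism A -> M}) (phi : {rmorphism L -> M}) (u : L) :
  (forall a, phi (f a) = g a) -> forall p, phi (ev f u p) = ev g (phi u) p.
Proof.
move=> fg p; elim/poly_ind: p => [|p a IHp]; first by rewrite !rmorph0.
by rewrite !(rmorphD, rmorphM) IHp !evX !evC fg.
Qed.

(** The indeterminates are nested as A[x][z][y]: the equation is monic only in y,
which must be outermost for the division. *)
Definition ev3 {A L : comNzRingType} (f : {rmorphism A -> L}) (x y z : L) :
    {rmorphism {poly {poly {poly A}}} -> L} :=
  ev (ev (ev f x) z) y.

Lemma ev3_bh_form (A L : comNzRingType) (f : {rmorphism A -> L}) q x y z :
  ev3 f x y z (bh_form q 'X%:P%:P 'X 'X%:P) = bh_form q x y z.
Proof.
by rewrite rmorph_bh_form /ev3 !(evX, evC).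
Qed.

(** Surjectivity is enough to transport the division to multivariate
polynomials. *)
Lemma ev3_mpoly_surj (A : comNzRingType) (g : {mpoly A[3]}) :
  exists P, g = ev3 (@mpolyC 3 _) 'X_0 'X_1 'X_2 P.
Proof.
pose var (i : 'I_3) : {poly {poly {poly A}}} := [:: 'X%:P%:P; 'X; 'X%:P]`_i.
have ev_var i : ev3 (@mpolyC 3 _) 'X_0 'X_1 'X_2 (var i) = 'X_i.
  case: i => [[|[|[|//]]]] lti; rewrite /var /= /ev3 ?(evX, evC);
    by congr ('X_ _); apply: val_inj.
exists (\sum_(m <- msupp g) (g@_m)%:P%:P%:P * \prod_i var i ^+ m i).
rewrite rmorph_sum [LHS]mpolyE; apply: eq_bigr => m _.
rewrite rmorphM /ev3 !evC rmorph_prod -mul_mpolyC mpolyXE_id.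
by congr (_ * _); apply: eq_bigr => i _; rewrite rmorphXn ev_var.
Qed.

Lemma meval_ev3 (A : comNzRingType) (v : 'I_3 -> A) P :
  (ev3 (@mpolyC 3 _) 'X_0 'X_1 'X_2 P).@[v] = ev3 idfun (v 0) (v 1) (v 2) P.
Proof.
rewrite -!(mevalXU v) /ev3; apply: rmorph_ev => {}P.
by apply: rmorph_ev => {}P; apply: rmorph_ev => a; exact: mevalC.
Qed.

End Evaluation.

Lemma closed_root_exists (K : closedFieldType) (x : K) n :
  (0 < n)%N -> exists s, s ^+ n = x.
Proof.
move=> n_gt0; have /closed_rootP[s] : size ('X^n - x%:P) != 1%N.
  by rewrite size_XnsubC // eqSS -lt0n.
by rewrite rootE !hornerE subr_eq0 => /eqP; exists s.
Qed.

Lemma unity_roots (K : closedFieldType) n : n%:R != 0 :> K ->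
  exists rs : seq K,
    [/\ uniq rs, size rs = n & forall z, z \in rs -> z ^+ n = 1].
Proof.
move=> n0; have n_gt0 : (0 < n)%N by rewrite lt0n; apply: contraNneq n0 => ->.
have [rs] := closed_field_poly_normal ('X^n - 1 : {poly K}).
rewrite (monicP (monicXnsubC _ _)) // scale1r => rsE; exists rs; split.
- by rewrite -separable_prod_XsubC -rsE separable_Xn_sub_1.
- have := congr1 (size \o val) rsE; rewrite /= size_XnsubC // size_prod_XsubC.
  by case.
- by move=> z; rewrite -root_prod_XsubC -rsE => /unity_rootP.
Qed.

Lemma quadratic_roots (K : closedFieldType) (x y : K) :
  exists a b : K, x = a * b /\ y = a + b.
Proof.
have [a aE] := @solve_monicpoly K 2 (fun i => if i is 0%N then - x else y) isT.
exists a, (y - a); split; last by rewrite addrC subrK.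
move: aE; rewrite big_ord_recl big_ord1 /= expr0 mulr1 expr1 => aE.
by rewrite mulrBr -expr2 aE; ring.
Qed.

Section VanishingIdeal.
Variables (K : closedFieldType) (q : nat).
Hypotheses (q_gt1 : (1 < q)%N) (qS_neq0 : q.+1%:R != 0 :> K).

(** The points over (x, z) have y-coordinates (w s)^q t + w s t^q with
w^(q+1) = 1.  Two of them coincide, for u <> v, only if s^q t = u v s t^q, and
the (q+1)-st power of that equality is x^q z = x z^q.  So r has q + 1 roots. *)
Lemma fiber_poly_eq0 (x z : K) (r : {poly K}) :
    x ^+ q * z != x * z ^+ q -> (size r <= q.+1)%N ->
    (forall s t, s ^+ q.+1 = x -> t ^+ q.+1 = z ->
       root r (s ^+ q * t + s * t ^+ q)) ->
  r = 0.
Proof.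
move=> generic sz_r r0.
have [s sx] := closed_root_exists _ x q.+1 isT.
have [t tz] := closed_root_exists _ z q.+1 isT.
have [rs [rs_uniq rs_size rs1]] := unity_roots _ _ qS_neq0.
pose y w := (w * s) ^+ q * t + w * s * t ^+ q.
apply: (@roots_geq_poly_eq0 _ r (map y rs)); last by rewrite size_map rs_size.
  apply/allP => _ /mapP[w w_rs ->]; apply: r0 => //.
  by rewrite exprMn rs1 // mul1r.
rewrite map_inj_in_uniq // => u v u_rs v_rs yE.
apply: contraNeq generic => neq_uv.
have uq1 := rs1 _ u_rs; have vq1 := rs1 _ v_rs.
have key : (v - u) * (s ^+ q * t - u * v * (s * t ^+ q)) = 0.
  have /eqP := congr1 (fun c => u * v * c) yE.
  rewrite -subr_eq0 => /eqP <-; rewrite /y !exprMn.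
  transitivity (u ^+ q.+1 * v * (s ^+ q * t) - u * v ^+ q.+1 * (s ^+ q * t)
                + u * v * (u - v) * (s * t ^+ q)); last by rewrite !exprS; ring.
  by rewrite uq1 vq1; ring.
move/eqP: key; rewrite mulf_eq0 subr_eq0 eq_sym (negPf neq_uv) /=.
rewrite subr_eq0 => /eqP /(congr1 (fun c => c ^+ q.+1)).
rewrite !exprMn uq1 vq1 !mul1r -!exprM ![(q * _)%N]mulnC !exprM sx tz => ->.
exact: eqxx.
Qed.

(** The condition defines a nonempty Zariski open set, hence meets the locus where
[c] does not vanish; [x] is chosen first, off the roots of the leading
coefficient, then [z]. *)
Lemma generic_fiber_neq0 (c : {poly {poly K}}) : c != 0 ->
  exists x z, x ^+ q * z != x * z ^+ q /\ ev (ev idfun x) z c != 0.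
Proof.
move=> c0.
have /closed_nonrootP[x] : lead_coef c * 'X != 0.
  by rewrite mulf_neq0 ?lead_coef_eq0 ?polyX_eq0.
rewrite rootM negb_or => /andP[cx x0]; rewrite rootE hornerX in x0.
pose cx_poly := map_poly (ev (idfun : {rmorphism K -> K}) x) c.
have cx_neq0 : cx_poly != 0.
  apply: contraNneq cx => /(congr1 (fun p : {poly K} => p`_(size c).-1)).
  by rewrite coef_map coef0 /= /horner_morph map_poly_id // rootE => ->.
have D_neq0 : x ^+ q *: 'X - x *: 'X^q != 0.
  apply: contraNneq x0 => /(congr1 (fun p : {poly K} => p`_q)).
  rewrite !coefE eqxx gtn_eqF // mulr0 mulr1 sub0r => /eqP.
  by rewrite oppr_eq0.
have /closed_nonrootP[z] := mulf_neq0 cx_neq0 D_neq0.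
rewrite rootM negb_or => /andP[cz Dz]; exists x, z; split=> //.
by move: Dz; rewrite rootE !hornerE subr_eq0.
Qed.

(** Divide by the equation in y.  Were the remainder nonzero, its leading
coefficient would be nonzero at some generic (x, z), while the remainder over
that (x, z) vanishes on a fiber with more points than its degree. *)
Lemma bh_poly_dvd (g : {mpoly K[3]}) :
    (forall v, v != 0 -> g.@[fun i => Phi_coord q v 0 i] = 0) ->
  exists h, g = h * bh_poly K q.
Proof.
move=> g0; have [P gP] := ev3_mpoly_surj _ g.
(* With the sign changed, the equation is monic in y. *)
pose B : {poly {poly {poly K}}} := bh_form q 'X%:P%:P 'X 'X%:P.
pose c : {poly {poly K}} := 'X%:P ^+ q * 'X + 'X%:P * 'X ^+ q.
have [] := dickson_monic _ ('X%:P * 'X : {poly {poly K}}) q.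
set D := dickson _ _ _ => mon szD.
have BE : - B = D + (- c)%:P.
  by rewrite /B /bh_form opprB /D /c !(polyCN, polyCD, polyCM, rmorphXn).
have ltD : (size (- c)%:P < size D)%N.
  by rewrite szD (leq_ltn_trans (size_polyC_leq1 _)).
have monB : - B \is monic by rewrite monicE BE lead_coefDl // -monicE.
have szB : size (- B) = q.+2 by rewrite BE size_polyDl.
have PE := Pdiv.RingMonic.rdivp_eq monB P.
set h := Pdiv.CommonRing.rdivp _ _ in PE.
set r := Pdiv.CommonRing.rmodp _ _ in PE.
have sz_r : (size r <= q.+1)%N.
  by rewrite -ltnS -szB Pdiv.CommonRing.ltn_rmodpN0 // monic_neq0.
exists (- ev3 (@mpolyC 3 _) 'X_0 'X_1 'X_2 h).
suff r0 : r = 0 by rewrite gP PE r0 addr0 mulrN rmorphN rmorphM ev3_bh_form mulNr.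
apply: contraTeq isT => r_neq0.
have /generic_fiber_neq0[x [z [generic]]] : lead_coef r != 0.
  by rewrite lead_coef_eq0.
case/negP.
suff rxz : map_poly (ev (ev idfun x) z) r = 0.
  have := congr1 (fun p : {poly K} => p`_(size r).-1) rxz.
  by rewrite coef_map coef0 => ->.
apply: (fiber_poly_eq0 _ _ _ generic) => [|s t sx tz].
  exact: leq_trans (size_poly _ _) sz_r.
pose v : 'rV[K]_2 := \row_i [:: s; t]`_i.
have v0 : v != 0.
  apply: contraNneq generic => /rowP vE.
  have := vE 0; rewrite !mxE /= => s0.
  by rewrite -sx s0 [0 ^+ q.+1]expr0n expr0n eqn0Ngt ltnW // !mul0r.
have /eqP := g0 v v0.
rewrite gP meval_ev3 !mxE /= sx tz PE rmorphD rmorphM rmorphN ev3_bh_form.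
by rewrite -sx -tz bh_form_param oppr0 mulr0 add0r.
Qed.

End VanishingIdeal.

(** * The curve as a zero locus *)

Section Coordinates.
Variables (K : fieldType) (n : nat).
Implicit Types (P : proj K n) (v : 'rV[K]_n.+1).

Lemma homcoord_inj v P P' : homcoord v P -> homcoord v P' -> P = P'.
Proof. by move=> vP vP'; apply: val_inj; rewrite vP vP'. Qed.

Lemma homcoordZ c v P : c != 0 -> homcoord v P -> homcoord (c *: v) P.
Proof.
move=> c0 vP; have v0 := homcoord_neq0 vP.
rewrite /homcoord vP; apply/esym/eqP; rewrite eqEdim !dim_vline scaler_eq0.
by rewrite (negPf c0) v0 -memvE memvZ ?memv_line.
Qed.

End Coordinates.

Lemma row3P (R : nmodType) (u v : 'rV[R]_3) :
  u 0 0 = v 0 0 -> u 0 1 = v 0 1 -> u 0 2 = v 0 2 -> u = v.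
Proof.
move=> e0 e1 e2; apply/rowP => -[[|[|[|//]]] lti].
- by rewrite (_ : Ordinal lti = 0) //; apply: val_inj.
- by rewrite (_ : Ordinal lti = 1) //; apply: val_inj.
- by rewrite (_ : Ordinal lti = 2) //; apply: val_inj.
Qed.

Definition row2 {R : nmodType} (s t : R) : 'rV[R]_2 := \row_i [:: s; t]`_i.
Definition row3 {R : nmodType} (x y z : R) : 'rV[R]_3 := \row_i [:: x; y; z]`_i.

Lemma Phi_coord_affine (K : fieldType) q (a : K) :
  Phi_coord q (row2 a 1) = row3 (a * a ^+ q) (a + a ^+ q) 1.
Proof.
by apply: row3P; rewrite !mxE /= ?exprS ?expr1n ?mulr1 // addrC.
Qed.

Section Locus.
Variables (K : closedFieldType) (q : nat).
Hypothesis q_gt0 : (0 < q)%N.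

(** Since K is closed, every scalar is a (q+1)-st power and is absorbed by
rescaling (s, t).  Outside the origin, the affine cone of the curve is
therefore the set of values of [Phi_coord]. *)
Lemma homcoord_ballico_hefez (v : 'rV[K]_3) P : homcoord v P ->
  ballico_hefez K q P <-> exists2 w, w != 0 & v = Phi_coord q w.
Proof.
move=> vP; split=> [[Q _ PQ]|[w w0 vE]].
  have := PhiE q (homcoord_repr Q); rewrite PQ => PhiP.
  have [c c0 ->] := homcoord_scale PhiP vP.
  have [d dc] := closed_root_exists K c q.+1 isT.
  exists (d *: proj_repr Q); last by rewrite Phi_coordZ dc.
  rewrite scaler_eq0 negb_or proj_repr_neq0 andbT.
  by apply: contraNneq c0 => d0; rewrite -dc d0 expr0n.
exists (proj_pt w0) => //; apply: homcoord_inj vP.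
by rewrite vE; apply: PhiE.
Qed.

(** Conversely to [bh_form_param]: for z = 0 the equation forces y = 0, which is
the image of (1 : 0); for z <> 0 scale to z = 1 and take for s the root of
T^2 - y T + x whose q-th power is the other root. *)
Lemma ballico_hefezP (v : 'rV[K]_3) P : homcoord v P ->
  ballico_hefez K q P <-> bh_form q (v 0 0) (v 0 1) (v 0 2) = 0.
Proof.
move=> vP; split.
  case/(homcoord_ballico_hefez _ _ vP) => w _ ->.
  by rewrite !mxE /= bh_form_param.
have [z0|z_neq0] := eqVneq (v 0 2) 0.
  rewrite z0 bh_form_z0 // => /eqP; rewrite oppr_eq0 expf_eq0 /= => /eqP y0.
  have x_neq0 : v 0 0 != 0.
    apply: contraNneq (homcoord_neq0 vP) => x0; apply/eqP.
    by apply: row3P; rewrite ?mxE ?x0 ?y0 ?z0.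
  have xinv : (v 0 0)^-1 != 0 by rewrite invr_eq0.
  apply/(homcoord_ballico_hefez _ _ (homcoordZ _ _ _ _ _ xinv vP)).
  exists (row2 1 0).
    by apply/eqP => /rowP /(_ 0) /eqP; rewrite !mxE oner_eq0.
  apply: row3P; rewrite !mxE /= ?expr1n ?mulVf // ?y0 ?z0 ?mulr0 ?expr0n //.
  by rewrite eqn0Ngt q_gt0 mulr0 addr0.
have zinv : (v 0 2)^-1 != 0 by rewrite invr_eq0.
move/(congr1 ( *%R ((v 0 2)^-1 ^+ q.+1))); rewrite mulr0 -bh_formZ mulVf //.
have [a [b [xE yE]]] :=
  quadratic_roots _ ((v 0 2)^-1 * v 0 0) ((v 0 2)^-1 * v 0 1).
rewrite xE yE bh_form_roots => /eqP; rewrite mulf_eq0 !subr_eq0 => ab.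
apply/(homcoord_ballico_hefez _ _ (homcoordZ _ _ _ _ _ zinv vP)).
have row_neq0 c : row2 c 1 != 0 :> 'rV[K]_2.
  by apply/eqP => /rowP /(_ 1) /eqP; rewrite !mxE oner_eq0.
have -> : (v 0 2)^-1 *: v = row3 (a * b) (a + b) 1.
  by apply: row3P; rewrite !mxE //= mulVf.
case/orP: ab => /eqP E; [exists (row2 a 1) | exists (row2 b 1)] => //;
  by rewrite Phi_coord_affine E // mulrC addrC.
Qed.

Lemma ballico_hefez_zero_locus :
  ballico_hefez K q = zero_locus (bh_poly K q).
Proof.
apply/seteqP; split=> P.
  by move=> BP v vP; rewrite bh_polyE; apply/(ballico_hefezP _ _ vP).
move=> /(_ _ (homcoord_repr P)); rewrite bh_polyE => f0.
by apply/(ballico_hefezP _ _ (homcoord_repr P)).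
Qed.

Lemma ballico_hefez_ideal : (1 < q)%N -> q.+1%:R != 0 :> K ->
  vanishing_ideal (ballico_hefez K q) = [set g | exists h, g = h * bh_poly K q].
Proof.
move=> q_gt1 qS_neq0; apply/seteqP; split=> g.
  move=> g0; apply: bh_poly_dvd => // v v0.
  by apply: (g0 (Phi q (proj_pt v0))); [exists (proj_pt v0)|exact: PhiE].
case=> h -> P; rewrite ballico_hefez_zero_locus => fP v vP.
by rewrite mevalM (fP v vP) mulr0.
Qed.

End Locus.

(** * Points over the finite field *)

Section FiniteField.
Variables (F : finFieldType) (K : closedFieldType) (iota : {rmorphism F -> K}).
Let q := #|F|.
Hypothesis char_q : [pchar K].-nat q.

(** X^q - X already splits over F. *)
Lemma frobenius_fixed (a : K) : a ^+ q = a -> exists c, a = iota c.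
Proof.
move=> aq; have /(congr1 (map_poly iota)) := finField_genPoly F.
rewrite rmorphB /= map_polyXn map_polyX rmorph_prod.
move/(congr1 (fun f => f.[a])); rewrite !hornerE aq subrr horner_prod.
move/esym/eqP; rewrite prodf_seq_eq0 => /hasP[c _].
by rewrite /= map_polyXsubC !hornerE subr_eq0 => /eqP; exists c.
Qed.

(** If neither root is the q-th power of the other, Frobenius, which preserves
their sum and product, must fix them; so they lie in F, and are distinct.
Conversely elements of F are their own q-th powers. *)
Lemma bh_form_neq0P (x y : F) :
  reflect (exists a b, [/\ a != b, x = a * b & y = a + b])
          (bh_form q x y 1 != 0).
Proof.
apply: (iffP idP) => [|[a [b [ab -> ->]]]]; last first.
  rewrite bh_form_roots !expf_card mulf_neq0 ?subr_eq0 //.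
  by rewrite eq_sym.
rewrite -(fmorph_eq0 iota) rmorph_bh_form rmorph1.
have [a [b [xE yE]]] := quadratic_roots K (iota x) (iota y).
rewrite xE yE bh_form_roots mulf_eq0 negb_or !subr_eq0 => /andP[aqb bqa].
have frob c : iota c ^+ q = iota c by rewrite -rmorphXn expf_card.
have aqa : a ^+ q = a.
  have : (a ^+ q - a) * (a ^+ q - b) = 0.
    have sumE : a + b = a ^+ q + b ^+ q by rewrite -exprDn_pchar // -yE frob.
    have prodE : a * b = a ^+ q * b ^+ q by rewrite -exprMn -xE frob.
    transitivity (a ^+ q * a ^+ q - (a + b) * a ^+ q + a * b); first by ring.
    by rewrite sumE prodE; ring.
  by move/eqP; rewrite mulf_eq0 !subr_eq0 (negPf aqb) orbF => /eqP.
have [c cE] := frobenius_fixed _ aqa.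
have bE : b = iota (y - c) by rewrite rmorphB yE -cE addrC addKr.
exists c, (y - c); split.
- by apply: contraNneq aqb => cb; rewrite aqa cE bE -cb.
- by apply: (fmorph_inj iota); rewrite rmorphM xE cE bE.
- by rewrite addrC subrK.
Qed.

(** A monic quadratic with distinct roots in F is determined by the two-element
set of its roots. *)
Lemma card_bh_form_neq0 :
  #|[set u : F * F | bh_form q u.1 u.2 1 != 0]%SET| = 'C(q, 2).
Proof.
pose coefs (A : {set F}) := (\prod_(a in A) a, \sum_(a in A) a).
have coefs2 a b : a != b -> coefs [set a; b]%SET = (a * b, a + b).
  by move=> ab; rewrite /coefs !big_setU1 ?inE //= !big_set1.
rewrite -card_draws -(@card_in_imset _ _ coefs) => [|A A']; last first.
  rewrite !inE => /cards2P[a [b [ab ->]]] /cards2P[c [d [cd ->]]].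
  rewrite !coefs2 // => -[prodE sumE].
  have mem t : ((t == a) || (t == b)) = ((t == c) || (t == d)).
    rewrite -!(subr_eq0 t) -!mulf_eq0; congr (_ == 0).
    transitivity (t ^+ 2 - (a + b) * t + a * b); first by ring.
    by rewrite prodE sumE; ring.
  by apply/setP => t; rewrite !inE mem.
apply: eq_card => -[x y]; rewrite !inE /=.
apply/bh_form_neq0P/imsetP => [[a [b [ab -> ->]]]|[A]].
  by exists [set a; b]%SET; rewrite ?coefs2 // inE cards2 ab.
rewrite inE => /cards2P[a [b [ab ->]]]; rewrite coefs2 // => -[-> ->].
by exists a, b.
Qed.

(** The affine chart z = 1 together with (1 : 0 : 0), the only point of the curve
on the line z = 0. *)
Definition chart (u : option (F * F)) : 'rV[F]_3 :=
  if u is Some (x, y) then row3 x y 1 else row3 1 0 0.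

Lemma chart_neq0 u : chart u != 0.
Proof.
by case: u => [[x y]|]; apply/eqP=> /rowP; [move/(_ 2)|move/(_ 0)];
  move/eqP; rewrite !mxE oner_eq0.
Qed.

Definition chart_pt (u : option (F * F)) : proj K 2 :=
  proj_map iota (proj_pt (chart_neq0 u)).

Lemma homcoord_chart u : homcoord (map_mx iota (chart u)) (chart_pt u).
Proof. exact: proj_mapE. Qed.

Lemma chart_pt_inj : injective chart_pt.
Proof.
move=> u u' E; have := homcoord_chart u'; rewrite -E => u'P.
have [c c0 /rowP cE] := homcoord_scale (homcoord_chart u) u'P.
have := cE 0; have := cE 1; have := cE 2; rewrite !mxE.
case: u u' {u'P E cE} => [[x y]|] [[x' y']|] //=;
  rewrite !mxE /= ?rmorph0 ?rmorph1.
- rewrite mulr1 => <-; rewrite !mul1r => /fmorph_inj -> /fmorph_inj -> //.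
- by rewrite mulr1 => c0'; rewrite -c0' eqxx in c0.
- by rewrite mulr0 => /eqP; rewrite oner_eq0.
Qed.

Definition bh_charts : {set option (F * F)} :=
  [set u | bh_form q (chart u 0 0) (chart u 0 1) (chart u 0 2) == 0]%SET.

Lemma card_bh_charts : #|bh_charts| = (q + 1 + (q * (q - 1)) %/ 2)%N.
Proof.
pose A := [set u : F * F | bh_form q u.1 u.2 1 != 0]%SET.
have -> : bh_charts = (None |: (Some @: ~: A))%SET.
  apply/setP => -[[x y]|]; rewrite !inE /= ?mxE /=.
    by rewrite mem_imset ?inE ?negbK //; apply: Some_inj.
  by rewrite bh_form_z0 ?expr0n /= ?oppr0 ?eqxx // ltnW // card_finNzRing_gt1.
rewrite cardsU1 card_imset; last exact: Some_inj.
have -> : None \notin (Some @: ~: A)%SET by apply/imsetP => -[].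
have := cardsC A; rewrite card_bh_form_neq0 card_prod -/q subn1 divn2 -bin2.
set C := 'C(q, 2) => sum_card.
(* Stated as a doubling to avoid division: q (q - 1) is even. *)
have C2 : (C + C = q * q.-1)%N.
  rewrite addnn -[RHS]odd_double_half /C bin2 oddM.
  by case: (q) => //= n; rewrite andNb.
have q_gt0 : (0 < q)%N by rewrite ltnW // card_finNzRing_gt1.
apply/eqP; rewrite -(eqn_add2l C) addnCA sum_card; apply/eqP.
have -> : (C + (q + 1 + C) = 1 + (q + (C + C)))%N by ring.
by rewrite C2 -mulnS prednK.
Qed.

Lemma rational_points_chart :
  rational_points iota (ballico_hefez K q) = chart_pt @` [set` bh_charts].
Proof.
have q_gt0 : (0 < q)%N by rewrite ltnW // card_finNzRing_gt1.
have on_chart u : ballico_hefez K q (chart_pt u) <-> u \in bh_charts.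
  rewrite (ballico_hefezP _ _ q_gt0 _ _ (homcoord_chart u)) inE.
  rewrite -(fmorph_eq0 iota) rmorph_bh_form.
  rewrite !(@mxE _ _ _ _ (fun _ _ => iota _)).
  by split=> [->|/eqP].
apply/seteqP; split=> P; last by case=> u /on_chart uP <-; split=> //; eexists.
case=> BP [R _ RP].
suff [u uP] : exists u, P = chart_pt u.
  by exists u => //; apply/on_chart; rewrite -uP.
have vR := homcoord_repr R; set v := proj_repr R in vR.
have vP := proj_mapE iota vR; rewrite RP in vP.
have from_coord c u : c != 0 -> c *: v = chart u -> exists u, P = chart_pt u.
  move=> c0 cv; exists u; apply: homcoord_inj (homcoord_chart u).
  by rewrite -cv map_mxZ; apply: homcoordZ; rewrite ?fmorph_eq0.
have [z0|z0] := eqVneq (v 0 2) 0; last first.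
  apply: (from_coord (v 0 2)^-1 (Some ((v 0 2)^-1 * v 0 0, (v 0 2)^-1 * v 0 1))).
    by rewrite invr_eq0.
  by apply: row3P; rewrite !mxE //= mulVf.
have /eqP := (ballico_hefezP _ _ q_gt0 _ _ vP).1 BP.
rewrite !mxE z0 rmorph0 bh_form_z0 // oppr_eq0 expf_eq0 fmorph_eq0 /= => /eqP y0.
have x0 : v 0 0 != 0.
  apply: contraNneq (homcoord_neq0 vR) => x0; apply/eqP.
  by apply: row3P; rewrite ?mxE ?x0 ?y0 ?z0.
apply: (from_coord (v 0 0)^-1 None); first by rewrite invr_eq0.
by apply: row3P; rewrite !mxE //= ?y0 ?z0 ?mulr0 ?mulVf.
Qed.

Lemma card_rational_points :
  rational_points iota (ballico_hefez K q) #= `I_(q + 1 + (q * (q - 1)) %/ 2)%N.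
Proof.
rewrite rational_points_chart -card_bh_charts.
have -> : chart_pt @` [set` bh_charts]
        = range (fun i : 'I_#|bh_charts| => chart_pt (enum_val i)).
  apply/seteqP; split=> P [u].
    move=> uB <-; exists (enum_rank_in uB u) => //.
    by rewrite enum_rankK_in.
  by move=> _ <-; exists (enum_val u) => //; apply: enum_valP.
apply: card_eq_trans (card_esym card_II).
by apply: inj_card_eq => i j _ _ /chart_pt_inj /enum_val_inj.
Qed.

End FiniteField.

(** * Degree and number of rational points *)

Theorem corollary2p3 (p e q : nat) (p_prime : prime p) (e_gt0 : (0 < e)%N)
    (q_def : q = (p ^ e)%N)
    (F : finFieldType) (card_F : #|F| = q)
    (K : closedFieldType) (iota : {rmorphism F -> K})
    (K_alg : forall x : K, algebraicOver iota x) :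
  plane_curve_of_degree iota q.+1 (ballico_hefez K q) /\
  rational_points iota (ballico_hefez K q) #= `I_(q + 1 + (q * (q - 1)) %/ 2)%N.
Proof.
have q_gt1 : (1 < q)%N by rewrite -card_F card_finNzRing_gt1.
have q_gt0 := ltnW q_gt1.
have charK : p \in [pchar K].
  by rewrite (fmorph_pchar iota) (@card_finPcharP _ _ e) // card_F.
split; last first.
  rewrite -card_F; apply: card_rational_points.
  by rewrite card_F q_def pnatX pnatE // charK.
have qS_neq0 : q.+1%:R != 0 :> K.
  (* p divides q, so q + 1 = 1 in K. *)
  have -> : q.+1%:R = 1 :> K; last exact: oner_neq0.
  by rewrite -add1n natrD q_def natrX (pcharf0 charK) expr0n gtn_eqF ?addr0.
split=> //; exists (bh_poly F q); rewrite map_bh_poly; split.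
- exact: bh_poly_neq0.
- exact: bh_poly_homog.
- exact: ballico_hefez_zero_locus.
- exact: ballico_hefez_ideal.
Qed.
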